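(* Suppose $\boldsymbol{\mathcal T}\in\mathbb{R}^{p_1\times\cdots\times p_d}$, $M_i\in\mathbb{R}^{(r_{i-1}p_i)\times r_i}$ for $1\le i\le d-1$, and $B_i\in\mathbb{R}^{(p_ir_i)\times r_{i-1}}$ for $2\le i\le d$, where $r_0=r_d=1$. (Forward sequential multiplication) Let $S_1=[\boldsymbol{\mathcal T}]_1$ and, for $k=1,\dots,d-1$, let $\widetilde S_k=M_k^\top S_k\in\mathbb{R}^{r_k\times(p_{k+1}\cdots p_d)}$ and, if $k<d-1$, $S_{k+1}=\mathrm{Reshape}(\widetilde S_k,r_kp_{k+1},p_{k+2}\cdots p_d)$. Then for any $1\le k\le d-1$, $$S_k=\bigl(I_{p_k}\otimes M_{\mathrm{prod},k-1}^{(L)\top}\bigr)[\boldsymbol{\mathcal T}]_k,\qquad\widetilde S_k=M_{\mathrm{prod},k}^{(L)\top}[\boldsymbol{\mathcal T}]_k,$$ where $I_{p_k}\otimes M_{\mathrm{prod},k-1}^{(L)\top}=I_{p_1}$ if $k=1$. (Backward sequential multiplication) Let $W_{d-1}=[\boldsymbol{\mathcal T}]_{d-1}$ and, for $k=d-1,\dots,1$, let $\widetilde W_k=W_kB_{k+1}\in\mathbb{R}^{(p_1\cdots p_k)\times r_k}$ and, if $k>1$, $W_{k-1}=\mathrm{Reshape}(\widetilde W_k,p_1\cdots p_{k-1},p_kr_k)$. Then for any $1\le k\le d-1$, $$W_k=[\boldsymbol{\mathcal T}]_k\bigl(B_{\mathrm{prod},k+2}^{(R)}\otimes I_{p_{k+1}}\bigr),\qquad\widetilde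 W_k=[\boldsymbol{\mathcal T}]_kB_{\mathrm{prod},k+1}^{(R)},$$ where $B_{\mathrm{prod},k+2}^{(R)}\otimes I_{p_{k+1}}=I_{p_d}$ if $k=d-1$. In particular, when TTOI is run on $\boldsymbol{\mathcal Y}\in\mathbb{R}^{p_1\times\cdots\times p_d}$ with input ranks $(r_1,\dots,r_{d-1})$, the matrices $R_k^{(t)},\widetilde R_k^{(t)}$ of the initialization ($t=0$) and of the forward updates ($t\in\{2,4,6,\dots\}$) satisfy, for all $1\le k\le d-1$, $$R_k^{(t)}=\Bigl(I_{p_k}\otimes(\widehat U^{(t)})_{\mathrm{prod},k-1}^{(L)\top}\Bigr)[\boldsymbol{\mathcal Y}]_k,\qquad\widetilde R_k^{(t)}=(\widehat U^{(t)})_{\mathrm{prod},k}^{(L)\top}[\boldsymbol{\mathcal Y}]_k .$$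
   Context: $d\ge2$ and $p_k,r_k$ are positive integers. The sequential unfolding $[\boldsymbol{\mathcal T}]_k\in\mathbb{R}^{(p_1\cdots p_k)\times(p_{k+1}\cdots p_d)}$ has entry $\boldsymbol{\mathcal T}_{i_1,\dots,i_d}$ at row $i_1+(i_2-1)p_1+\cdots+(i_k-1)p_1\cdots p_{k-1}$ and column $i_{k+1}+(i_{k+2}-1)p_{k+1}+\cdots+(i_d-1)p_{k+1}\cdots p_{d-1}$. $\mathrm{Reshape}$ of matrices is column-major: for $A\in\mathbb{R}^{q_1\times q_2q_3}$ and $\widetilde A\in\mathbb{R}^{q_1q_2\times q_3}$, $\widetilde A=\mathrm{Reshape}(A,q_1q_2,q_3)$ and $A=\mathrm{Reshape}(\widetilde A,q_1,q_2q_3)$ iff $\widetilde A_{(i_2-1)q_1+i_1,i_3}=A_{i_1,(i_3-1)q_2+i_2}$ for all indices. $U\otimes V$ is the usual Kronecker product, with blocks $U_{ij}V$. Sequential products. For $M_i\in\mathbb{R}^{(p_ir_{i-1})\times r_i}$ ($1\le i\le d-1$): $M_{\mathrm{prod},1}^{(L)}=M_1$, $M_{\mathrm{prod},k+1}^{(L)}=(I_{p_{k+1}}\otimes M_{\mathrm{prod},k}^{(L)})M_{k+1}$ for $1\le k\le d-2$. For $B_j\in\mathbb{R}^{(p_jr_j)\times r_{j-1}}$ ($2\le j\le d$): $B_{\mathrm{prod},d}^{(R)}=B_d$, $B_{\mathrm{prod},k}^{(R)}=(B_{\mathrm{prod},k+1}^{(R)}\otimes I_{p_k})B_k$ for $2\le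 k\le d-1$. TTOI (tensor-train orthogonal iteration). $\mathrm{SVD}^L_r(A)$ and $\mathrm{SVD}^R_r(A)$ denote the matrices of the leading $r$ left, respectively right, singular vectors of $A$ (any choice in case of ties); it is understood that $r_k\le r_{k-1}p_k$ and $r_{k-1}\le p_kr_k$ so that these exist. Initialization ($t=0$): $R_1^{(0)}=[\boldsymbol{\mathcal Y}]_1$; for $k=1,\dots,d-1$, $\widehat U_k^{(0)}=\mathrm{SVD}^L_{r_k}(R_k^{(0)})$, $\widetilde R_k^{(0)}=\widehat U_k^{(0)\top}R_k^{(0)}$, and if $k<d-1$, $R_{k+1}^{(0)}=\mathrm{Reshape}(\widetilde R_k^{(0)},r_kp_{k+1},p_{k+2}\cdots p_d)$. Backward update ($t$ odd): $\widehat V_d^{(t)}=\mathrm{SVD}^R_{r_{d-1}}(\widetilde R_{d-1}^{(t-1)})$; for $k=d-1,\dots,2$, $\widehat V_k^{(t)}=\mathrm{SVD}^R_{r_{k-1}}\bigl(\widetilde R_{k-1}^{(t-1)}((\widehat V^{(t)})_{\mathrm{prod},k+1}^{(R)}\otimes I_{p_k})\bigr)$. Forward update ($t\ge2$ even): $R_1^{(t)}=[\boldsymbol{\mathcal Y}]_1$; for $k=1,\dots,d-1$, $\widehat U_k^{(t)}=\mathrm{SVD}^L_{r_k}\bigl(R_k^{(t)}(\widehat V^{(t-1)})_{\mathrm{prod},k+1}^{(R)}\bigr)$, $\widetilde R_k^{(t)}=\widehat U_k^{(t)\top}R_k^{(t)}$, and if $k<d-1$, $R_{k+1}^{(t)}=\mathrm{Reshape}(\widetilde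 R_k^{(t)},r_kp_{k+1},p_{k+2}\cdots p_d)$. In the last display of the claim, $I_{p_k}\otimes(\widehat U^{(t)})_{\mathrm{prod},k-1}^{(L)\top}$ is read as $I_{p_1}$ for $k=1$. *)

(* Defs.v *)
From HB Require Import structures.
From mathcomp Require Import all_boot all_order all_algebra.
From mathcomp Require Export mxtens.
From mathcomp Require Export reals.

Set Implicit Arguments.
Unset Strict Implicit.
Unset Printing Implicit Defensive.

Import Order.TTheory GRing.Theory Num.Theory.
Local Open Scope ring_scope.

(* Conventions.
   - The modes are numbered 1, ..., d as in the usual notation, so [p k] and
     [r k] are p_k and r_k; a multi-index [x] has i_(l+1) - 1 = [x l] for
     [l : 'I_d].
   - Families such as [M : forall k, 'M_(p k * r k.-1, r k)] are total in
     [k : nat]; only the members with k between 1 and d (d-1 for M) are ever used.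
   - [A *t B] is the Kronecker product.  Its row (or column) index
     [mxtens_index (i, j)] is [i * n + j], so the first factor is the slow
     one: a column-major index i_1 + (i_2 - 1) q_1 lives in ['I_(q_2 * q_1)].
     This is why the sizes p_k r_(k-1) and p_k r_k are written
     [p k * r k.-1] and [r k * p k]. *)

(* p_a ... p_b *)
Definition pprod (p : nat -> nat) (a b : nat) : nat :=
  (\prod_(a <= m < b.+1) p m)%N.

(* Change of the type of a matrix along an equality of dimensions, found by
   decision.  All uses below are between sizes that are equal under the
   standing assumptions r_0 = r_d = 1; see [recastE] and the lemmas
   following the definitions. *)
Definition recast (R : realType) (m n m' n' : nat) (A : 'M[R]_(m, n)) :
    'M[R]_(m', n') :=
  conform_mx (0 : 'M[R]_(m', n')) A.
Arguments recast {R m n m' n'} A.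

Lemma recastE (R : realType) (m n m' n' : nat) (em : m = m') (en : n = n')
  (A : 'M[R]_(m, n)) : recast A = castmx (em, en) A.
Proof. by case: m' / em; case: n' / en; rewrite /recast conform_mx_id castmx_id. Qed.

Section Tensor.

Variables (R : realType) (d : nat) (p : nat -> nat).

Definition multi_index := {dffun forall l : 'I_d, 'I_(p l.+1)}.

Definition tensor := multi_index -> R.

Definition row_index (k : nat) (x : multi_index) : nat :=
  (\sum_(l < d | l < k) x l * pprod p 1 l)%N.

Definition col_index (k : nat) (x : multi_index) : nat :=
  (\sum_(l < d | k <= l) x l * pprod p k.+1 l)%N.

(* The sum has exactly one term: see [unfoldingE]. *)
Definition unfolding (T : tensor) (k : nat) :
    'M[R]_(pprod p 1 k, pprod p k.+1 d) :=
  \matrix_(i, j) \sum_(x : multi_index |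
     (row_index k x == i :> nat) && (col_index k x == j :> nat)) T x.

End Tensor.

Definition reshape_tall (R : realType) (q1 q2 q3 : nat)
    (A : 'M[R]_(q1, q3 * q2)) : 'M[R]_(q2 * q1, q3) :=
  \matrix_(i, i3) A (mxtens_unindex i).2
                    (mxtens_index (i3, (mxtens_unindex i).1)).

Definition reshape_wide (R : realType) (q1 q2 q3 : nat)
    (A : 'M[R]_(q2 * q1, q3)) : 'M[R]_(q1, q3 * q2) :=
  \matrix_(i1, j) A (mxtens_index ((mxtens_unindex j).2, i1))
                    (mxtens_unindex j).1.

Lemma reshape_tallE (R : realType) (q1 q2 q3 : nat) (A : 'M[R]_(q1, q3 * q2))
    (i1 : 'I_q1) (i2 : 'I_q2) (i3 : 'I_q3) :
  reshape_tall A (mxtens_index (i2, i1)) i3 = A i1 (mxtens_index (i3, i2)).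
Proof. by rewrite mxE mxtens_indexK. Qed.

Lemma reshape_wideE (R : realType) (q1 q2 q3 : nat) (A : 'M[R]_(q2 * q1, q3))
    (i1 : 'I_q1) (i2 : 'I_q2) (i3 : 'I_q3) :
  reshape_wide A i1 (mxtens_index (i3, i2)) = A (mxtens_index (i2, i1)) i3.
Proof. by rewrite mxE mxtens_indexK. Qed.

Section Products.

Variables (R : realType) (d : nat) (p r : nat -> nat).

Section Left.

Variable M : forall k : nat, 'M[R]_(p k * r k.-1, r k).

(* The value at 0 is not used. *)
Fixpoint Lprod (k : nat) : 'M[R]_(pprod p 1 k, r k) :=
  match k with
  | 0 => 0
  | k'.+1 =>
      if k' == 0%N then recast (M k'.+1)
      else recast (((1%:M : 'M[R]_(p k'.+1)) *t Lprod k') *m M k'.+1)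
  end.

(* I_(p_k) (x) Lprod_(k-1)^T, read as I_(p_1) for k = 1 *)
Definition Lfactor (k : nat) : 'M[R]_(p k * r k.-1, pprod p 1 k) :=
  if k == 1%N then recast (1%:M : 'M[R]_(p k))
  else recast ((1%:M : 'M[R]_(p k)) *t (Lprod k.-1)^T).

Definition forward_multiplication (T : tensor R d p)
    (S : forall k : nat, 'M[R]_(p k * r k.-1, pprod p k.+1 d))
    (St : forall k : nat, 'M[R]_(r k, pprod p k.+1 d)) : Prop :=
  [/\ S 1%N = recast (unfolding T 1),
      forall k : nat, (1 <= k <= d.-1)%N -> St k = (M k)^T *m S k
    & forall k : nat, (1 <= k < d.-1)%N ->
        S k.+1 =
          reshape_tall (recast (St k) : 'M[R]_(r k, pprod p k.+2 d * p k.+1))].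

End Left.

Section Right.

Variable B : forall k : nat, 'M[R]_(r k * p k, r k.-1).

Fixpoint Rprod_rec (n k : nat) : 'M[R]_(pprod p k d, r k.-1) :=
  match n with
  | 0 => recast (B k)
  | n'.+1 => recast ((Rprod_rec n' k.+1 *t (1%:M : 'M[R]_(p k))) *m B k)
  end.

Definition Rprod (k : nat) : 'M[R]_(pprod p k d, r k.-1) := Rprod_rec (d - k) k.

(* Rprod_(k+2) (x) I_(p_(k+1)), read as I_(p_d) for k = d-1 *)
Definition Rfactor (k : nat) : 'M[R]_(pprod p k.+1 d, r k.+1 * p k.+1) :=
  if k.+1 == d then recast (1%:M : 'M[R]_(p k.+1))
  else recast (Rprod k.+2 *t (1%:M : 'M[R]_(p k.+1))).

Definition backward_multiplication (T : tensor R d p)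
    (W : forall k : nat, 'M[R]_(pprod p 1 k, r k.+1 * p k.+1))
    (Wt : forall k : nat, 'M[R]_(pprod p 1 k, r k)) : Prop :=
  [/\ W d.-1 = recast (unfolding T d.-1),
      forall k : nat, (1 <= k <= d.-1)%N -> Wt k = W k *m B k.+1
    & forall k : nat, (1 <= k < d.-1)%N ->
        W k =
          reshape_wide (recast (Wt k.+1)
                          : 'M[R]_(p k.+1 * pprod p 1 k, r k.+1))].

End Right.

End Products.

Definition is_svd (R : realType) (m n : nat) (A : 'M[R]_(m, n))
    (U : 'M[R]_m) (s : nat -> R) (V : 'M[R]_n) : Prop :=
  [/\ U^T *m U = 1%:M, V^T *m V = 1%:M,
      (forall i : nat, 0 <= s i),
      (forall i j : nat, (i <= j)%N -> s j <= s i)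
    & A = U *m (\matrix_(i < m, j < n) (if i == j :> nat then s i else 0))
            *m V^T].

(* [Uh] is a possible value of SVD^L_c(A). *)
Definition svdL (R : realType) (m n c : nat) (A : 'M[R]_(m, n))
    (Uh : 'M[R]_(m, c)) : Prop :=
  exists (hc : (c <= m)%N) (U : 'M[R]_m) (s : nat -> R) (V : 'M[R]_n),
    is_svd A U s V /\ Uh = colsub (widen_ord hc) U.

(* [Vh] is a possible value of SVD^R_c(A). *)
Definition svdR (R : realType) (m n c : nat) (A : 'M[R]_(m, n))
    (Vh : 'M[R]_(n, c)) : Prop :=
  exists (hc : (c <= n)%N) (U : 'M[R]_m) (s : nat -> R) (V : 'M[R]_n),
    is_svd A U s V /\ Vh = colsub (widen_ord hc) V.

(* The matrices produced by a run of tensor-train orthogonal iteration on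
   [Y].  [Uh t], [Rk t] and [Rt t] are meaningful for even [t] only, [Vh t]
   for odd [t] only. *)
Record ttoi (R : realType) (d : nat) (p r : nat -> nat) (Y : tensor R d p)
    (Uh : forall t k : nat, 'M[R]_(p k * r k.-1, r k))
    (Vh : forall t k : nat, 'M[R]_(r k * p k, r k.-1))
    (Rk : forall t k : nat, 'M[R]_(p k * r k.-1, pprod p k.+1 d))
    (Rt : forall t k : nat, 'M[R]_(r k, pprod p k.+1 d)) : Prop := {
  ttoi_init_svd : forall k : nat, (1 <= k <= d.-1)%N ->
    svdL (Rk 0%N k) (Uh 0%N k);
  ttoi_init_mul : forward_multiplication (Uh 0%N) Y (Rk 0%N) (Rt 0%N);
  ttoi_backward_last : forall t : nat, odd t ->
    forall k : nat, k.+1 = d ->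
      svdR (recast (Rt t.-1 k) : 'M[R]_(r k, r k.+1 * p k.+1)) (Vh t k.+1);
  ttoi_backward : forall t : nat, odd t ->
    forall k : nat, (2 <= k.+1 <= d.-1)%N ->
      svdR (Rt t.-1 k *m
              (recast (Rprod d (Vh t) k.+2 *t (1%:M : 'M[R]_(p k.+1)))
                 : 'M[R]_(pprod p k.+1 d, r k.+1 * p k.+1)))
           (Vh t k.+1);
  ttoi_forward_svd : forall t : nat, (2 <= t)%N -> ~~ odd t ->
    forall k : nat, (1 <= k <= d.-1)%N ->
      svdL (Rk t k *m Rprod d (Vh t.-1) k.+1) (Uh t k);
  ttoi_forward_mul : forall t : nat, (2 <= t)%N -> ~~ odd t ->
    forward_multiplication (Uh t) Y (Rk t) (Rt t)
}.

Section Facts.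

Variables (R : realType) (d : nat) (p r : nat -> nat).

Lemma pprodSr k : (p k.+1 * pprod p 1 k = pprod p 1 k.+1)%N.
Proof. by rewrite /pprod [RHS]big_nat_recr //= mulnC. Qed.

Lemma pprodSl k : (k <= d)%N -> (pprod p k.+1 d * p k = pprod p k d)%N.
Proof. by move=> kd; rewrite /pprod [RHS]big_ltn // mulnC. Qed.

Lemma pprod1 k : pprod p k k = p k.
Proof. by rewrite /pprod big_nat1. Qed.

Lemma Lprod1 (M : forall k : nat, 'M[R]_(p k * r k.-1, r k))
    (e : (p 1 * r 0 = pprod p 1 1)%N) :
  Lprod M 1 = castmx (e, erefl) (M 1%N).
Proof. exact: recastE. Qed.

Lemma LprodS (M : forall k : nat, 'M[R]_(p k * r k.-1, r k)) k :
  (0 < k)%N ->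
  Lprod M k.+1 =
    castmx (pprodSr k, erefl) (((1%:M : 'M[R]_(p k.+1)) *t Lprod M k) *m M k.+1).
Proof. by case: k => // k _; rewrite /= (recastE (pprodSr k.+1) erefl). Qed.

Lemma Rprod_last (B : forall k : nat, 'M[R]_(r k * p k, r k.-1))
    (e : (r d * p d = pprod p d d)%N) :
  Rprod d B d = castmx (e, erefl) (B d).
Proof. by rewrite /Rprod subnn /= (recastE e erefl). Qed.

Lemma RprodS (B : forall k : nat, 'M[R]_(r k * p k, r k.-1)) k (kd : (k < d)%N) :
  Rprod d B k =
    castmx (pprodSl (ltnW kd), erefl)
      ((Rprod d B k.+1 *t (1%:M : 'M[R]_(p k))) *m B k).
Proof. by rewrite /Rprod -(subnSK kd) /= (recastE (pprodSl (ltnW kd)) erefl). Qed.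

Lemma radix_lt (f : nat -> nat) (a n : nat) :
  (forall l, (a <= l < n)%N -> (f l < p l.+1)%N) -> (a <= n)%N ->
  (\sum_(a <= l < n) f l * pprod p a.+1 l < pprod p a.+1 n)%N.
Proof.
elim: n => [|n IH] hf; first by rewrite leqn0 => /eqP ->; rewrite /pprod !big_geq.
rewrite leq_eqVlt => /orP [/eqP <-|]; first by rewrite /pprod !big_geq.
rewrite ltnS => an; rewrite big_nat_recr //=.
have -> : (pprod p a.+1 n.+1 = p n.+1 * pprod p a.+1 n)%N.
  by rewrite /pprod big_nat_recr //= mulnC.
have h1 : (f n < p n.+1)%N by apply: hf; rewrite an ltnSn.
have h2 := IH (fun l hl => hf l (ltac:(case/andP: hl => -> /= /ltnW; exact))) an.
apply: (@leq_trans ((f n).+1 * pprod p a.+1 n)%N); last by rewrite leq_mul2r h1 orbT.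
by rewrite mulSn ltn_add2r.
Qed.

Lemma radix_inj (f g : nat -> nat) (a n : nat) :
  (forall l, (a <= l < n)%N -> (f l < p l.+1)%N) ->
  (forall l, (a <= l < n)%N -> (g l < p l.+1)%N) ->
  (\sum_(a <= l < n) f l * pprod p a.+1 l =
   \sum_(a <= l < n) g l * pprod p a.+1 l)%N ->
  forall l, (a <= l < n)%N -> f l = g l.
Proof.
elim: n => [|n IH] hf hg e l; first by rewrite ltn0 andbF.
case/andP=> al ln; have an : (a <= n)%N by apply: leq_trans al _.
have w l' : (a <= l' < n)%N -> (a <= l' < n.+1)%N.
  by case/andP=> -> /= /ltnW.
have hf' l' (h : (a <= l' < n)%N) : (f l' < p l'.+1)%N by apply/hf/w.
have hg' l' (h : (a <= l' < n)%N) : (g l' < p l'.+1)%N by apply/hg/w.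
have lf := radix_lt hf' an; have lg := radix_lt hg' an.
move: e; rewrite !big_nat_recr //= => e.
have P0 : (0 < pprod p a.+1 n)%N by apply: leq_ltn_trans lf.
have en : f n = g n.
  move: (congr1 (divn^~ (pprod p a.+1 n)) e) => /=.
  by rewrite !divnDMl ?P0 // !divn_small.
move: e; rewrite en => /addIn e.
move: ln; rewrite ltnS leq_eqVlt => /orP [/eqP -> //|ln].
by apply: (IH hf' hg' e); rewrite al.
Qed.

Let digit (x : multi_index d p) (l : nat) : nat :=
  if insub l is Some o then x o else 0%N.

Let digitE (x : multi_index d p) (l : 'I_d) : digit x l = x l.
Proof. by rewrite /digit valK. Qed.

Let digit_lt (x : multi_index d p) l : (l < d)%N -> (digit x l < p l.+1)%N.
Proof. by move=> h; rewrite (digitE x (Ordinal h)); apply: ltn_ord. Qed.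

Lemma row_indexE k x : (k <= d)%N ->
  row_index k x = (\sum_(0 <= l < k) digit x l * pprod p 1 l)%N.
Proof.
move=> kd; rewrite big_mkord (big_ord_widen _ (fun l => digit x l * pprod p 1 l)%N kd).
by apply: eq_bigr => l _; rewrite digitE.
Qed.

Lemma col_indexE k x :
  col_index k x = (\sum_(k <= l < d) digit x l * pprod p k.+1 l)%N.
Proof.
rewrite (big_nat_widenl _ 0) // big_mkord /=.
by apply: eq_bigr => l _; rewrite digitE.
Qed.

Lemma row_index_lt k (x : multi_index d p) : (k <= d)%N ->
  (row_index k x < pprod p 1 k)%N.
Proof.
move=> kd; rewrite row_indexE //; apply: radix_lt => // l /andP [_ lk].
by apply: digit_lt; apply: leq_trans kd.
Qed.

Lemma col_index_lt k (x : multi_index d p) : (k <= d)%N ->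
  (col_index k x < pprod p k.+1 d)%N.
Proof.
by move=> kd; rewrite col_indexE; apply: radix_lt => // l /andP [_ /digit_lt].
Qed.

Lemma index_inj k (x y : multi_index d p) : (k <= d)%N ->
  row_index k x = row_index k y -> col_index k x = col_index k y -> x = y.
Proof.
move=> kd; rewrite !row_indexE // !col_indexE => er ec.
apply/ffunP => l; apply: val_inj; rewrite /= -!digitE.
have [lk|kl] := ltnP l k.
  by apply: (radix_inj _ _ er) => // l' /andP [_ h]; apply: digit_lt; apply: leq_trans kd.
apply: (radix_inj _ _ ec); last by rewrite kl /=.
  by move=> l' /andP [_ /digit_lt].
by move=> l' /andP [_ /digit_lt].
Qed.

Lemma unfoldingE (T : tensor R d p) k (x : multi_index d p)
    (i : 'I_(pprod p 1 k)) (j : 'I_(pprod p k.+1 d)) : (k <= d)%N ->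
  row_index k x = i -> col_index k x = j -> unfolding T k i j = T x.
Proof.
move=> kd ei ej; rewrite mxE (bigD1 x) ?ei ?ej ?eqxx //= big1 ?addr0 // => y.
case/andP=> /andP [/eqP e1 /eqP e2] /eqP []; apply: (index_inj kd).
  by rewrite e1 ei.
by rewrite e2 ej.
Qed.

End Facts.

(* Main.v *)
Require Import Defs.
From mathcomp Require Import all_boot all_order all_algebra.

Set Implicit Arguments.
Unset Strict Implicit.
Unset Printing Implicit Defensive.

Import Order.TTheory GRing.Theory Num.Theory.
Local Open Scope ring_scope.

(** Both halves of the statement rest on two facts about reshaping.

    In column-major order, moving the mode [k+1] from the columns to the rows of
    the [k]-th unfolding is exactly a reshape: [unfolding_tall] says that the
    reshape of [unfolding T k] is [unfolding T k.+1].  This is the uniqueness of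
    Euclidean division: the column index of [unfolding T k] is
    [i_(k+1) - 1 + p_(k+1) j], with [j] the column index of [unfolding T k.+1],
    and the row index of the latter is [(i_(k+1) - 1) p_1...p_k + i], with [i] the
    row index of the former.

    A reshape only touches the mode that moves, so a multiplication on the side
    that the mode joins is carried along, acting as the identity on that mode:
    [reshape_tall (A *m X)] is [(1 *t A) *m reshape_tall X], and
    [reshape_wide (X *m A)] is [reshape_wide X *m (A *t 1)].

    Hence if [St k = (Lprod M k)^T *m unfolding T k], reshaping gives
    [S k.+1 = (1 *t (Lprod M k)^T) *m unfolding T k.+1].  Multiplying by
    [(M k.+1)^T] turns the left factor into the transpose of
    [(1 *t Lprod M k) *m M k.+1], which is [Lprod M k.+1], and the induction goes
    on.  The backward half is the same argument read from mode [d] down.  Tensor-train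
    orthogonal iteration on [Y] runs the forward multiplication at every even time,
    the computed singular vectors being the factors, so its claim is an instance of
    the forward half. *)

(** * Changes of type along equalities of dimensions *)

(** Dimensions such as [pprod p 1 k.+1] and [p k.+1 * pprod p 1 k] are equal but not
    convertible.  Each lemma takes the equalities of dimensions as hypotheses, so
    that they can be eliminated once here, where the dimensions are variables. *)

Section Recast.

Variable R : realType.

Lemma recast_id m n (A : 'M[R]_(m, n)) : recast A = A.
Proof. by rewrite (recastE erefl erefl) castmx_id. Qed.

Lemma recast_coord m n m' n' (em : m = m') (en : n = n') (A : 'M[R]_(m, n))
    (i : 'I_m') (j : 'I_n') :
  recast A i j = A (cast_ord (esym em) i) (cast_ord (esym en) j).
Proof. by rewrite (recastE em en) castmxE. Qed.

Lemma trmx_recast m n m' n' (A : 'M[R]_(m, n)) :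
  m = m' -> n = n' -> (recast A : 'M_(m', n'))^T = recast A^T.
Proof. by move=> em en; case: m' / em; case: n' / en; rewrite !recast_id. Qed.

Lemma recast_mulr m n q q' (A : 'M[R]_(m, n)) (B : 'M_(n, q)) :
  q = q' -> recast (A *m B) = A *m recast B :> 'M_(m, q').
Proof. by move=> e; case: q' / e; rewrite !recast_id. Qed.

Lemma recast_mull m m' n q (A : 'M[R]_(m, n)) (B : 'M_(n, q)) :
  m = m' -> recast (A *m B) = recast A *m B :> 'M_(m', q).
Proof. by move=> e; case: m' / e; rewrite !recast_id. Qed.

(** Moves a recast of the inner dimension across a product, which is how the
    unfoldings, recast to be reshaped, get back their own type. *)
Lemma mulmx_recast m n n' q (A : 'M[R]_(m, n)) (B : 'M_(n', q)) :
  n = n' -> recast A *m B = A *m recast B.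
Proof. by move=> e; case: n' / e B => B; rewrite !recast_id. Qed.

Lemma recast1_mul m n q (B : 'M[R]_(n, q)) l :
  l = m -> l = n -> recast (1%:M : 'M[R]_l) *m B = recast B :> 'M_(m, q).
Proof.
by move=> em en; case: m / em; case: n / en B => B; rewrite !recast_id mul1mx.
Qed.

Lemma mul_recast1 m n q (B : 'M[R]_(q, n)) l :
  l = m -> l = n -> B *m recast (1%:M : 'M[R]_l) = recast B :> 'M_(q, m).
Proof.
by move=> em en; case: m / em; case: n / en B => B; rewrite !recast_id mulmx1.
Qed.

(** * Reshaping and multiplication *)

Lemma reshape_tallK q1 q2 q3 :
  cancel (@reshape_tall R q1 q2 q3) (@reshape_wide R q1 q2 q3).
Proof.
by move=> A; apply/matrixP=> i j; case: (mxtens_indexP j) => i3 i2;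
  rewrite reshape_wideE reshape_tallE.
Qed.

(** Row [(i2, i1)] of the reshape reads row [i1] of the original matrix, so a left
    multiplication mixes the [i1] and leaves the slow index [i2] fixed: it becomes
    the block diagonal matrix with [q2] copies of [A]. *)
Lemma reshape_tall_mul a q1 q2 q3 (A : 'M[R]_(a, q1)) (X : 'M_(q1, q3 * q2)) :
  reshape_tall (A *m X) = ((1%:M : 'M_q2) *t A) *m reshape_tall X.
Proof.
apply/matrixP=> i i3; case: (mxtens_indexP i) => i2 i1.
rewrite reshape_tallE !mxE (reindex (@mxtens_index q2 q1)) /=; last first.
  by exists (@mxtens_unindex _ _) => z _; rewrite (mxtens_indexK, mxtens_unindexK).
transitivity (\sum_(j2 < q2) \sum_(j1 < q1)
    (1%:M : 'M[R]_q2) i2 j2 * A i1 j1 * X j1 (mxtens_index (i3, j2))).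
  rewrite (bigD1 i2) //= [X in _ + X]big1 ?addr0 => [|j2 /negbTE nj].
    by apply: eq_bigr => j1 _; rewrite !mxE eqxx mul1r.
  by apply: big1 => j1 _; rewrite !mxE eq_sym nj !mul0r.
by rewrite pair_big; apply: eq_bigr => -[j2 j1] _; rewrite tensmxE reshape_tallE.
Qed.

(** Here the mode [i2] joins the columns as the fast index, so it is the second
    factor of the Kronecker product that is the identity. *)
Lemma reshape_wide_mul q1 q2 q3 b (X : 'M[R]_(q2 * q1, q3)) (A : 'M_(q3, b)) :
  reshape_wide (X *m A) = reshape_wide X *m (A *t (1%:M : 'M_q2)).
Proof.
apply/matrixP=> i1 i; case: (mxtens_indexP i) => i3 i2.
rewrite reshape_wideE !mxE (reindex (@mxtens_index q3 q2)) /=; last first.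
  by exists (@mxtens_unindex _ _) => z _; rewrite (mxtens_indexK, mxtens_unindexK).
transitivity (\sum_(j3 < q3) \sum_(j2 < q2)
    X (mxtens_index (j2, i1)) j3 * (A j3 i3 * (1%:M : 'M[R]_q2) j2 i2)).
  apply: eq_bigr => j3 _; rewrite (bigD1 i2) //= big1 ?addr0 => [|j2 /negbTE nj].
    by rewrite !mxE eqxx mulr1.
  by rewrite !mxE nj !mulr0.
by rewrite pair_big; apply: eq_bigr => -[j3 j2] _; rewrite tensmxE reshape_wideE.
Qed.

End Recast.

(** * Consecutive unfoldings *)

Section Unfolding.

Variables (R : realType) (d : nat) (p : nat -> nat).

Lemma row_indexS k (kd : (k < d)%N) (x : multi_index d p) :
  row_index k.+1 x = (x (Ordinal kd) * pprod p 1 k + row_index k x)%N.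
Proof.
rewrite /row_index (bigD1 (Ordinal kd)) //=; congr addn.
by apply: eq_bigl => l; rewrite -val_eqE /= ltnS [RHS]ltn_neqAle andbC.
Qed.

Lemma col_indexS k (kd : (k < d)%N) (x : multi_index d p) :
  col_index k x = (col_index k.+1 x * p k.+1 + x (Ordinal kd))%N.
Proof.
rewrite /col_index (bigD1 (Ordinal kd)) //= addnC; congr addn; last first.
  by rewrite /pprod big_geq ?muln1.
rewrite big_distrl /=; apply: eq_big => [l|l kl].
  by rewrite -val_eqE /= [RHS]ltn_neqAle eq_sym andbC.
have {}kl : (k < l)%N.
  by case/andP: kl => kl nl; rewrite ltn_neqAle kl eq_sym andbT.
by rewrite -mulnA; congr muln; rewrite /pprod big_ltn // mulnC.
Qed.

(** Euclidean division by [q] recovers the two digits. *)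
Lemma eq_radix q a b a' b' : (b < q)%N -> (b' < q)%N ->
  (a * q + b == a' * q + b')%N = (a == a') && (b == b').
Proof.
move=> bq bq'; apply/eqP/andP => [e|[/eqP -> /eqP -> //]].
have q0 : (0 < q)%N by apply: leq_ltn_trans bq.
have ea : a = a'.
  by move: (congr1 (divn^~ q) e); rewrite !divnMDl // !divn_small // !addn0.
by move: e; rewrite ea => /addnI ->.
Qed.

(** A multi-index contributes to the same entry on both sides because both
    pairs of indices carry the same three digits: the row index for modes
    [1..k], the mode [k+1], and the column index for modes [k+2..d]. *)
Lemma unfolding_tall (T : tensor R d p) k : (k < d)%N ->
  reshape_tall (recast (unfolding T k)
                  : 'M_(pprod p 1 k, pprod p k.+2 d * p k.+1)) =
  recast (unfolding T k.+1).
Proof.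
move=> kd; apply/matrixP=> i i3; case: (mxtens_indexP i) => i2 i1.
rewrite reshape_tallE (recast_coord erefl (esym (pprodSl p kd))).
rewrite (recast_coord (esym (pprodSr p k)) erefl) !mxE.
apply: eq_bigl => x /=.
rewrite (row_indexS kd) (col_indexS kd) !eq_radix ?row_index_lt ?ltn_ord //.
  by rewrite andbCA andbC -!andbA andbCA.
exact: ltnW.
Qed.

Lemma unfolding_wide (T : tensor R d p) k : (k < d)%N ->
  reshape_wide (recast (unfolding T k.+1)
                  : 'M_(p k.+1 * pprod p 1 k, pprod p k.+2 d)) =
  recast (unfolding T k).
Proof. by move=> kd; rewrite -unfolding_tall // reshape_tallK. Qed.

End Unfolding.

(** * Forward multiplication *)

Section Forward.

Variables (R : realType) (d : nat) (p r : nat -> nat).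
Hypothesis r0 : r 0%N = 1%N.

(** Writing the recursion through [Lfactor] makes the case [k = 1] uniform with the
    others: [Lfactor M 1] is the identity, of size [p 1 * r 0 = p 1] because
    [r 0 = 1]. *)
Lemma Lprod_factor (M : forall k, 'M[R]_(p k * r k.-1, r k)) k :
  (0 < k)%N -> Lprod M k = (Lfactor M k)^T *m M k.
Proof.
case: k => // -[|k] _.
  have e : p 1%N = (p 1 * r 0)%N by rewrite r0 muln1.
  have e' : p 1%N = pprod p 1 1 by rewrite pprod1.
  by rewrite /Lfactor /= trmx_recast // trmx1 recast1_mul.
have e := pprodSr p k.+1.
rewrite [LHS]/= recast_mull // /Lfactor [_.+2.-1]/= trmx_recast //.
by rewrite trmx_tens trmx1 trmxK.
Qed.

Lemma forward_multiplicationP (T : tensor R d p)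
    (M : forall k, 'M[R]_(p k * r k.-1, r k))
    (S : forall k, 'M[R]_(p k * r k.-1, pprod p k.+1 d))
    (St : forall k, 'M[R]_(r k, pprod p k.+1 d)) :
  forward_multiplication M T S St ->
  forall k, (1 <= k <= d.-1)%N ->
    S k = Lfactor M k *m unfolding T k /\
    St k = (Lprod M k)^T *m unfolding T k.
Proof.
case=> S1 StE SS.
have MtL k : (0 < k)%N -> (M k)^T *m Lfactor M k = (Lprod M k)^T.
  by move=> k0; rewrite Lprod_factor // trmx_mul trmxK.
suff SE k : (1 <= k <= d.-1)%N -> S k = Lfactor M k *m unfolding T k.
  move=> k kd; split; first exact: SE.
  case/andP: (kd) => k0 _.
  by rewrite StE // SE // mulmxA MtL.
elim: k => // -[_ _|k IH /andP[_ kd]].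
  have e : p 1%N = (p 1 * r 0)%N by rewrite r0 muln1.
  by rewrite S1 /Lfactor /= recast1_mul ?pprod1.
have kd1 : (1 <= k.+1 <= d.-1)%N by rewrite /= ltnW.
have kd2 : (k.+1 < d)%N by apply: leq_trans kd (leq_pred d).
rewrite SS ?kd // StE // IH // mulmxA MtL //.
rewrite recast_mulr; last by rewrite -(pprodSl p kd2).
rewrite reshape_tall_mul unfolding_tall // /Lfactor /=.
by rewrite mulmx_recast // -(pprodSr p k.+1).
Qed.

End Forward.

(** * Backward multiplication *)

Section Backward.

Variables (R : realType) (d : nat) (p r : nat -> nat).
Hypothesis rd : r d = 1%N.

(** The mirror image of [Lprod_factor]: the exceptional case is now the last mode,
    where the identity has size [r d * p d = p d]. *)
Lemma Rprod_factor (B : forall k, 'M[R]_(r k * p k, r k.-1)) k :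
  (k < d)%N -> Rprod d B k.+1 = Rfactor d B k *m B k.+1.
Proof.
move=> kd; rewrite /Rfactor; case: eqP => [dE|/eqP nd].
  have e : (r k.+1 * p k.+1 = p k.+1)%N by rewrite dE rd mul1n.
  by rewrite /Rprod -dE subnn /= recast1_mul ?pprod1.
have kd1 : (k.+1 < d)%N by rewrite ltn_neqAle nd kd.
have e := pprodSl p kd.
by rewrite /Rprod -(subnSK kd1) /= recast_mull // e.
Qed.

Lemma backward_multiplicationP (T : tensor R d p)
    (B : forall k, 'M[R]_(r k * p k, r k.-1))
    (W : forall k, 'M[R]_(pprod p 1 k, r k.+1 * p k.+1))
    (Wt : forall k, 'M[R]_(pprod p 1 k, r k)) :
  backward_multiplication B T W Wt ->
  forall k, (1 <= k <= d.-1)%N ->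
    W k = unfolding T k *m Rfactor d B k /\
    Wt k = unfolding T k *m Rprod d B k.+1.
Proof.
case=> W1 WtE WS.
(* The multiplication starts at [d.-1] and goes down, so the induction is on the
   distance [n] from [d.-1] to [k]. *)
suff WE n k : (n + k)%N = d.-1 -> (0 < k)%N -> W k = unfolding T k *m Rfactor d B k.
  move=> k kd; case/andP: (kd) => k0 kd1.
  have {}WE : W k = unfolding T k *m Rfactor d B k.
    by apply: (WE (d.-1 - k)%N); rewrite // subnK.
  have kd2 : (k < d)%N by case: (d) kd1 k0 => [|//]; case: (k).
  by split=> //; rewrite WtE // WE -mulmxA Rprod_factor.
elim: n k => [|n IH] k.
  rewrite add0n => kE k0; have dE : k.+1 = d by case: (d) kE k0 => [->|? ->].
  have e : (r k.+1 * p k.+1 = p k.+1)%N by rewrite dE rd mul1n.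
  have e' : pprod p k.+1 d = p k.+1 by rewrite -dE pprod1.
  move: W1; rewrite -kE => ->; rewrite /Rfactor; case: eqP => // _.
  by rewrite mul_recast1.
rewrite addSn -addnS => nE k0.
have kd1 : (k.+1 <= d.-1)%N by rewrite -nE leq_addl.
have kd2 : (k.+1 < d)%N by case: (d) kd1.
have kd := ltnW kd2.
rewrite WS ?k0 // WtE // (IH k.+1) // -mulmxA -Rprod_factor //.
rewrite recast_mull; last by rewrite pprodSr.
rewrite reshape_wide_mul unfolding_wide // /Rfactor ltn_eqF //.
by rewrite mulmx_recast // pprodSl.
Qed.

End Backward.

Theorem lemma3p3 (R : realType) (d : nat) (p r : nat -> nat)
  (hd : (2 <= d)%N)
  (hp : forall k : nat, (1 <= k <= d)%N -> (0 < p k)%N)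
  (hr : forall k : nat, (1 <= k <= d.-1)%N -> (0 < r k)%N)
  (hr0 : r 0%N = 1%N) (hrd : r d = 1%N)
  (T : tensor R d p)
  (M : forall k : nat, 'M[R]_(p k * r k.-1, r k))
  (B : forall k : nat, 'M[R]_(r k * p k, r k.-1)) :
  [/\ (* forward sequential multiplication *)
      forall (S : forall k : nat, 'M[R]_(p k * r k.-1, pprod p k.+1 d))
             (St : forall k : nat, 'M[R]_(r k, pprod p k.+1 d)),
        forward_multiplication M T S St ->
        forall k : nat, (1 <= k <= d.-1)%N ->
          S k = Lfactor M k *m unfolding T k /\
          St k = (Lprod M k)^T *m unfolding T k,
      (* backward sequential multiplication *)
      forall (W : forall k : nat, 'M[R]_(pprod p 1 k, r k.+1 * p k.+1))
             (Wt : forall k : nat, 'M[R]_(pprod p 1 k, r k)),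
        backward_multiplication B T W Wt ->
        forall k : nat, (1 <= k <= d.-1)%N ->
          W k = unfolding T k *m Rfactor d B k /\
          Wt k = unfolding T k *m Rprod d B k.+1
    & (* tensor-train orthogonal iteration *)
      (forall k : nat, (1 <= k <= d)%N -> (r k <= r k.-1 * p k)%N) ->
      (forall k : nat, (1 <= k <= d)%N -> (r k.-1 <= p k * r k)%N) ->
      forall (Y : tensor R d p)
             (Uh : forall t k : nat, 'M[R]_(p k * r k.-1, r k))
             (Vh : forall t k : nat, 'M[R]_(r k * p k, r k.-1))
             (Rk : forall t k : nat, 'M[R]_(p k * r k.-1, pprod p k.+1 d))
             (Rt : forall t k : nat, 'M[R]_(r k, pprod p k.+1 d)),
        ttoi Y Uh Vh Rk Rt ->
        forall t : nat, ~~ odd t ->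
        forall k : nat, (1 <= k <= d.-1)%N ->
          Rk t k = Lfactor (Uh t) k *m unfolding Y k /\
          Rt t k = (Lprod (Uh t) k)^T *m unfolding Y k].
Proof.
split.
- by move=> S St; apply: forward_multiplicationP.
- by move=> W Wt; apply: backward_multiplicationP.
move=> _ _ Y Uh Vh Rk Rt run [|t] ht; apply: forward_multiplicationP => //.
  exact: ttoi_init_mul run.
by apply: (ttoi_forward_mul run) => //; case: t ht.
Qed.
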